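(* Let $m\ge 2$ and $n\ge m$ be integers, let $X_1,\ldots,X_n$ be i.i.d. random variables with values in a measurable space $\mathcal{X}$, and let $h:\mathcal{X}^m\to\mathbb{R}$ be measurable. Let $m_h=\mathrm{E}\,h(X_1,\ldots,X_m)$, let $U_n(h)$ be the U-statistic of order $m$ with kernel $h$, and let $k=\lfloor n/m\rfloor$. Suppose $Z=h(X_1,\ldots,X_m)$ is sub-exponential with parameters $(\nu^2,\alpha)$, where $\nu>0$ and $\alpha>0$. Then for all $t>0$, $$P(|U_n(h)-m_h|\ge t)\le 2\exp\left(-\frac{k}{2}\min\left\{\frac{t^2}{\nu^2},\,\frac{t}{\alpha}\right\}\right),$$ and for every $\delta\in(0,1)$, with probability at least $1-\delta$, $$|U_n(h)-m_h|\le\nu\sqrt{\frac{2\log(2/\delta)}{k}}+\frac{2\alpha\log(2/\delta)}{k}.$$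
   Context: The U-statistic of order $m$ with kernel $h$ based on $X_1,\ldots,X_n$ is $$U_n(h)=\frac{(n-m)!}{n!}\sum_{(i_1,\ldots,i_m)\in I_n^m}h(X_{i_1},\ldots,X_{i_m}),$$ where $I_n^m=\{(i_1,\ldots,i_m):1\le i_j\le n,\ i_j\ne i_l\text{ if }j\ne l\}$ is the set of all $m$-tuples of distinct integers between $1$ and $n$. The kernel $h$ is not assumed symmetric. A real random variable $Z$ with mean $\mu$ is sub-exponential with parameters $(\nu^2,\alpha)$, $\alpha>0$, if $\mathrm{E}\,e^{\lambda(Z-\mu)}\le e^{\lambda^2\nu^2/2}$ for all $\lambda\in\mathbb{R}$ with $|\lambda|\le 1/\alpha$. *)

(* Defs.v *)
From HB Require Import structures.
From mathcomp Require Import all_boot all_order all_algebra.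
From mathcomp Require Import all_classical all_reals all_analysis.

Set Implicit Arguments.
Unset Strict Implicit.
Unset Printing Implicit Defensive.

Import Order.TTheory GRing.Theory Num.Theory.
Import numFieldNormedType.Exports.

Local Open Scope classical_set_scope.
Local Open Scope ring_scope.

Definition mutually_independent d d' (Omega : measurableType d)
    (S : measurableType d') (R : realType) (P : probability Omega R)
    (I : finType) (X : I -> {RV P >-> S}) : Prop :=
  forall (J : {set I}) (A : I -> set S), (forall i, measurable (A i)) ->
    P (\bigcap_(i in [set` J]) (X i @^-1` A i)) =
    (\prod_(i in J) P (X i @^-1` A i))%E.

Definition identically_distributed d d' (Omega : measurableType d)
    (S : measurableType d') (R : realType) (P : probability Omega R)
    (I : finType) (X : I -> {RV P >-> S}) : Prop :=
  forall (i j : I) (A : set S), measurable A ->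
    distribution P (X i) A = distribution P (X j) A.

Definition iid d d' (Omega : measurableType d) (S : measurableType d')
    (R : realType) (P : probability Omega R)
    (I : finType) (X : I -> {RV P >-> S}) : Prop :=
  mutually_independent X /\ identically_distributed X.

(* The second parameter is the variance proxy nu^2 itself, not nu. *)
Definition sub_exponential d (Omega : measurableType d) (R : realType)
    (P : probability Omega R) (Z : Omega -> R) (nu2 alpha : R) : Prop :=
  [/\ 0 < alpha,
      P.-integrable [set: Omega] (EFin \o Z) &
      forall lambda : R, `|lambda| <= 1 / alpha ->
        ('M_P (fun w => (Z w - fine 'E_P[Z])%R) lambda <=
         (expR (lambda ^+ 2 * nu2 / 2))%:E)%E].

(* Value at the sample x of the U-statistic with kernel h; the set I_n^m of
   m-tuples of distinct indices is the set of duplicate-free i : m.-tuple 'I_n,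
   and map_tuple x i is (x_{i_1}, ..., x_{i_m}). *)
Definition Ustat (R : realType) (S : Type) (m n : nat)
    (h : m.-tuple S -> R) (x : 'I_n -> S) : R :=
  ((n - m)`!)%:R / (n`!)%:R *
  \sum_(i : m.-tuple 'I_n | uniq i) h (map_tuple x i).

(* Main.v *)
Require Import Defs.
From HB Require Import structures.
From mathcomp Require Import all_boot all_order all_algebra.
From mathcomp Require Import fingroup perm.
From mathcomp Require action primitive_action alt.
From mathcomp Require Import all_classical all_reals all_analysis.
From mathcomp Require Import measurable_realfun.
From mathcomp Require Import ring lra.

(** The statistic is an average of averages of independent copies of
[h(X_1, ..., X_m)], up to permuting the sample. For a permutation [sigma] of
the indices let
<<
  V_sigma = (1/k) sum_(j < k) h (X_(sigma (j m)), ..., X_(sigma (j m + m - 1))),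
>>
which uses [k = n %/ m] disjoint blocks of the permuted sample. By symmetry
every tuple of distinct indices is hit equally often by a given block when
[sigma] varies, so the mean of [V_sigma] over all [sigma] is the U-statistic
([Ustat_mean_blocks]). The summands of one [V_sigma] are independent and
distributed like [Z = h (X_1, ..., X_m)],
whereas the [V_sigma] are dependent on each other; convexity of the exponential
([expR_mean_le]) makes that dependence harmless, and
<<
  E exp (lambda (U - m_h)) <= (E exp ((lambda / k) (Z - m_h))) ^ k
>>
([Ustat_mgf_le]). Hence [U] is sub-exponential with parameters
[(nu^2 / k, alpha / k)], and the usual Chernoff argument ([subexp_tail]) gives
the tail bound. The confidence bound follows by inserting a radius for which
both members of the minimum are at least [2 log (2 / delta) / k].

The measure-theoretic content is that functions of disjoint blocks of
mutually independent variables are independent. Mutual independence is only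
about events [X_i \in A_i], so it determines the law of a tuple on boxes; boxes
form a generating pi-system of the product sigma-algebra, and uniqueness of
measures extends both the product rule ([segment_indep]) and the equality of
laws ([segment_identically_distributed]) to all measurable sets. Fubini's
theorem then turns independence into the product rule for expectations
([expectation_prod_blocks]). *)

Import Order.TTheory GRing.Theory Num.Theory.
Import numFieldNormedType.Exports.

Local Open Scope classical_set_scope.
Local Open Scope ring_scope.

Set Implicit Arguments.
Unset Strict Implicit.

(** * Averaging over permutations *)

(** This is the [m]-transitivity of the symmetric group. *)
Lemma uniq_tuple_perm (T : finType) (m : nat) (c c' : m.-tuple T) :
  uniq c -> uniq c' -> exists s : {perm T}, c' = map_tuple s c.
Proof.
move=> uc uc'.
have mT : (m <= #|T|)%N.
  by rewrite -(primitive_action.card_uniq_tuple uc) max_card.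
have tr := primitive_action.ntransitive_weak mT (alt.Sym_trans T).
have inD (t : m.-tuple T) : uniq t ->
    t \in primitive_action.dtuple_on m [set: T]%SET.
  by move=> ut; rewrite inE ut; apply/fintype.subsetP => x _; rewrite inE.
have := inD _ uc'; rewrite -(action.atransP tr _ (inD _ uc)).
by case/imsetP => s _ ->; exists s; apply: val_inj.
Qed.

(** Instead of counting the permutations that send [c] to a given tuple, sum
over both [sigma] and [c]: by transitivity the left-hand side does not depend
on [c], and for a fixed [sigma] the map [c |-> sigma c] permutes the
duplicate-free tuples. The factor [(#|T| - m)`!] is the quotient of the numbers
[#|T|`!] of permutations and [#|T| ^_ m] of such tuples. *)
Lemma sum_perm_map_tuple (R : numDomainType) (T : finType) (m : nat)
    (g : m.-tuple T -> R) (c : m.-tuple T) : uniq c ->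
  \sum_(s : {perm T}) g (map_tuple s c) =
  (\sum_(i : m.-tuple T | uniq i) g i) *+ (#|T| - m)`!.
Proof.
move=> uc.
have mT : (m <= #|T|)%N.
  by rewrite -(primitive_action.card_uniq_tuple uc) max_card.
pose F c := \sum_(s : {perm T}) g (map_tuple s c).
have FE (c' : m.-tuple T) : uniq c' -> F c' = F c.
  move=> uc'; have [s ->] := uniq_tuple_perm uc uc'.
  rewrite /F [RHS](reindex_inj (mulgI s)) /=; apply: eq_bigr => u _.
  by congr g; apply: eq_from_tnth => i; rewrite !tnth_map permM.
have cardU : #|[pred i : m.-tuple T | uniq i]| = (#|T| ^_ m)%N.
  rewrite -(card_uniq_tuples _ predT) cardsE; apply: eq_card => i.
  rewrite -[RHS]/(all predT i && uniq i).
  by have /allP -> : forall x, x \in val i -> predT x.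
apply: (@pmulrnI R (#|T| ^_ m)%N); first by rewrite ffact_gt0.
rewrite -mulrnA mulnC ffact_fact // -/(F c).
transitivity (\sum_(c' : m.-tuple T | uniq c') F c').
  by rewrite (eq_bigr (fun=> F c)) // sumr_const cardU.
rewrite exchange_big /=.
rewrite (eq_bigr (fun=> \sum_(i : m.-tuple T | uniq i) g i)); last first.
  move=> s _; rewrite [RHS](reindex_inj (h := fun i => map_tuple s i)) /=.
    by apply: eq_bigl => i; rewrite map_inj_uniq //; exact: perm_inj.
  move=> i j /(congr1 val) /= /inj_map ij; apply: val_inj; apply: ij.
  exact: perm_inj.
by rewrite sumr_const -cardsT -alt.card_Sym.
Qed.

(** Jensen's inequality: average, with weights [w], the lower bound of [expR] by
its tangent line at the mean. *)
Lemma expR_mean_le (R : realType) (I : finType) (w x : I -> R) :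
  (forall i, 0 <= w i) -> \sum_i w i = 1 ->
  expR (\sum_i w i * x i) <= \sum_i w i * expR (x i).
Proof.
move=> w0 w1; set mu := \sum_i w i * x i.
have -> : expR mu = \sum_i w i * (expR mu * (1 + (x i - mu))).
  under eq_bigr do rewrite mulrCA.
  rewrite -mulr_sumr.
  under eq_bigr do rewrite mulrDr mulr1 mulrBr.
  by rewrite big_split /= sumrB -mulr_suml w1 -/mu mul1r subrr addr0 mulr1.
apply: ler_sum => i _; apply: ler_wpM2l => //.
rewrite -[in leRHS](subrK mu (x i)) expRD mulrC ler_wpM2r ?expR_ge0 //.
exact: expR_ge1Dx.
Qed.

(** * Independence and laws of tuples *)

(** The sides are indexed by [nat] rather than ['I_p], so that sides of
consecutive tuples can be concatenated without casts. *)
Definition box (S : Type) (p : nat) (A : nat -> set S) : set (p.-tuple S) :=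
  [set t | forall i : 'I_p, A i (tnth t i)].

Lemma measurable_box d (S : measurableType d) (p : nat) (A : nat -> set S) :
  (forall i, measurable (A i)) -> measurable (@box S p A).
Proof.
move=> mA.
have -> : @box S p A = \bigcap_(i in [set: 'I_p]) (@tnth p S ^~ i @^-1` A i).
  by apply/seteqP; split => t /= h i; [move=> _|]; exact: h.
apply: fin_bigcap_measurable => // i _; rewrite -[_ @^-1` _]setTI.
exact: measurable_tnth.
Qed.

(** Boxes are closed under intersection and generate the product sigma-algebra,
since the preimages under the coordinate maps are boxes. *)
Lemma measure_eq_of_box d (S : measurableType d) (R : realType) (p : nat)
    (m1 m2 : {measure set (p.-tuple S) -> \bar R}) :
  (m1 setT < +oo)%E ->
  (forall A, (forall i, measurable (A i)) -> m1 (box A) = m2 (box A)) ->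
  forall B, measurable B -> m1 B = m2 B.
Proof.
move=> m1T m12.
pose G := [set B | exists2 A : nat -> set S,
  forall i, measurable (A i) & B = @box S p A].
apply: (measure_unique G (fun=> setT)) => //.
- apply/seteqP; split; last first.
    apply: smallest_sub; first exact: sigma_algebra_measurable.
    by move=> _ [A mA ->]; exact: measurable_box.
  apply: smallest_sub; first exact: smallest_sigma_algebra.
  apply: (big_ind (fun F => F `<=` <<s G >>)) => //.
    by move=> F F' FG FG' B [/FG|/FG'].
  move=> i _ _ [B mB <-]; apply: sub_sigma_algebra.
  exists (fun j => if j == i :> nat then B else setT).
    by move=> j; case: ifP.
  rewrite setTI; apply/seteqP; split => t /= h.
    by move=> j; case: eqP => // /val_inj ->.
  by have := h i; rewrite eqxx.
- move=> _ _ [A mA ->] [A' mA' ->]; exists (fun i => A i `&` A' i).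
    by move=> i; exact: measurableI.
  by apply/seteqP; split => t => [[h h'] i //|h]; split => i; have [] := h i.
- by move=> _; exists (fun=> setT) => //; apply/seteqP.
- by rewrite bigcup_const.
- by move=> A [A' mA' ->]; exact: m12.
Qed.

(** With the event [D] fixed, both sides of the product rule are finite measures
in [B]: the law of [Y] restricted to [D], and a multiple of the law of [Y]. *)
Lemma indep_of_box d d' (Omega : measurableType d) (S : measurableType d')
    (R : realType) (P : probability Omega R) (p : nat)
    (Y : Omega -> p.-tuple S) (D : set Omega) :
  measurable_fun setT Y -> measurable D ->
  (forall A, (forall i, measurable (A i)) ->
    P (Y @^-1` box A `&` D) = (P (Y @^-1` box A) * P D)%E) ->
  forall B, measurable B -> P (Y @^-1` B `&` D) = (P (Y @^-1` B) * P D)%E.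
Proof.
move=> mY mD boxE B mB.
pose c : {nonneg R} := NngNum (fine_ge0 (measure_ge0 P D)).
pose Y' : {mfun Omega >-> p.-tuple S} := mfun_Sub (mem_set mY).
have cE : c%:num%:E = P D.
  by rewrite /= fineK // fin_num_measure.
pose m1 := pushforward (mrestr P mD) Y'.
pose m2 := mscale c (distribution P Y').
rewrite [LHS](_ : _ = m1 B) // [RHS](_ : _ = m2 B); last first.
  by rewrite /m2 /mscale cE muleC.
have m1T : (m1 setT < +oo)%E.
  rewrite /m1 /pushforward /mrestr preimage_setT setTI.
  by rewrite ltey_eq fin_num_measure.
apply: (@measure_eq_of_box _ _ _ _ m1 m2) => //.
move=> A mA.
rewrite -[LHS]/(P (Y @^-1` box A `&` D)).
by rewrite -[RHS]/(c%:num%:E * P (Y @^-1` box A))%E cE muleC boxE.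

Qed.

(** Independence says that the joint law of [Y1] and [Y2] is the product of
their laws; integrate [f1 * f2] against it by Tonelli's theorem. *)
Lemma expectation_mul_indep d d1 d2 (Omega : measurableType d)
    (T1 : measurableType d1) (T2 : measurableType d2)
    (R : realType) (P : probability Omega R)
    (Y1 : {RV P >-> T1}) (Y2 : {RV P >-> T2})
    (f1 : T1 -> \bar R) (f2 : T2 -> \bar R) :
  (forall A B, measurable A -> measurable B ->
    P (Y1 @^-1` A `&` Y2 @^-1` B) = (P (Y1 @^-1` A) * P (Y2 @^-1` B))%E) ->
  measurable_fun [set: T1] f1 -> measurable_fun [set: T2] f2 ->
  (forall x, 0 <= f1 x)%E -> (forall x, 0 <= f2 x)%E ->
  (\int[P]_w (f1 (Y1 w) * f2 (Y2 w)) =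
   \int[P]_w f1 (Y1 w) * \int[P]_w f2 (Y2 w))%E.
Proof.
move=> ind mf1 mf2 f10 f20.
have mY12 : measurable_fun setT (fun w => (Y1 w, Y2 w)).
  exact: measurable_fun_pair.
pose Y12 : {RV P >-> (T1 * T2)%type} := mfun_Sub (mem_set mY12).
pose m1 := distribution P Y1; pose m2 := distribution P Y2.
pose g (z : T1 * T2) := (f1 z.1 * f2 z.2)%E.
have mg : measurable_fun setT g.
  by apply: emeasurable_funM; exact: measurableT_comp.
have g0 z : (0 <= g z)%E by exact: mule_ge0.
transitivity (\int[distribution P Y12]_z g z)%E.
  by rewrite ge0_integral_distribution.
transitivity (\int[m1 \x m2]_z g z)%E.
  apply: eq_measure_integral => A mA _.
  by apply/esym; apply: product_measure_unique => // B C mB mC; exact: ind.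
rewrite fubini_tonelli1 // /fubini_F /g /=.
under eq_integral do rewrite ge0_integralZl //.
rewrite ge0_integralZr //; last exact: integral_ge0.
by rewrite !ge0_integral_distribution.
Qed.

(** The sample is read in the order given by the sequence [s] of indices;
indexing that sequence by [nat] lets segments of any offset and length share
one type of sequences. *)
Definition segment d d' (Omega : measurableType d) (S : measurableType d')
    (R : realType) (P : probability Omega R) (I : Type)
    (X : I -> {RV P >-> S}) (s : nat -> I) (a p : nat) (w : Omega) :
    p.-tuple S :=
  [tuple X (s (a + i)%N) w | i < p].

Lemma block_index_lt (k m j i : nat) :
  (j < k)%N -> (i < m)%N -> (j * m + i < k * m)%N.
Proof.
move=> jk im; apply: (@leq_trans (j.+1 * m)).
  by rewrite mulSn addnC ltn_add2r.
by rewrite leq_mul2r jk orbT.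
Qed.

Section independent_segments.
Context d d' (Omega : measurableType d) (S : measurableType d') (R : realType)
  (P : probability Omega R) (I : finType) (X : I -> {RV P >-> S}).
Implicit Types (s : nat -> I) (A B : nat -> set S).

Lemma measurable_segment s a p : measurable_fun setT (segment X s a p).
Proof.
apply/measurable_fun_tnthP => i.
apply: (eq_measurable_fun (X (s (a + i)%N))) => // w _.
by rewrite /= tnth_mktuple.
Qed.

Lemma measurable_segment_preimage s a p (B : set (p.-tuple S)) :
  measurable B -> measurable (segment X s a p @^-1` B).
Proof. by move=> mB; rewrite -[_ @^-1` _]setTI; exact: measurable_segment. Qed.

(** Intersections and products run over positions instead of index sets, so that
the sample and its permutations are treated alike. *)
Lemma prob_bigcap_indep s q A : mutually_independent X ->
  {in gtn q &, injective s} -> (forall i, measurable (A i)) ->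
  P (\bigcap_(l in `I_q) (X (s l) @^-1` A l)) =
  (\prod_(l < q) P (X (s l) @^-1` A l))%E.
Proof.
move=> ind sinj mA.
(* [A] carried over from positions to indices; injectivity of [s] leaves at
   most one set in the intersection. *)
pose A' j := \bigcap_(l in [set l | (l < q)%N /\ s l = j]) A l.
have A'E (l : nat) : (l < q)%N -> A' (s l) = A l.
  move=> lq; apply/seteqP; split=> x; first by apply.
  by move=> Ax l' [l'q /sinj ->].
pose J := [set s l | l : 'I_q]%SET.
have mA' j : measurable (A' j).
  apply: fin_bigcap_measurable => //.
  by apply: (@sub_finite_set _ _ `I_q) => // l [].
rewrite [X in P X](_ : _ = \bigcap_(j in [set` J]) (X j @^-1` A' j)).
  rewrite ind // big_imset /=; first by apply: eq_bigr => l _; rewrite A'E.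
  by move=> l l' _ _ /sinj; rewrite !inE => /(_ _ _)/val_inj ->.
apply/seteqP; split=> w /= h.
  move=> _ /imsetP[l _ ->] /=; rewrite (A'E _ (ltn_ord l)).
  exact: (h l (ltn_ord l)).
by move=> l lq /=; rewrite -A'E //; apply: h => /=; apply/imsetP;
  exists (Ordinal lq).
Qed.

Lemma prob_segment_box s a p A : mutually_independent X ->
  {in gtn p &, injective (fun l => s (a + l)%N)} ->
  (forall i, measurable (A i)) ->
  P (segment X s a p @^-1` box A) =
  (\prod_(i < p) P (X (s (a + i)%N) @^-1` A i))%E.
Proof.
move=> ind sinj mA.
rewrite -(prob_bigcap_indep (s := fun l => s (a + l)%N)) //; congr (P _).
apply/seteqP; split=> w /= h l; last by have := h l (ltn_ord l);
  rewrite tnth_mktuple.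
by move=> lp; have := h (Ordinal lp); rewrite tnth_mktuple.
Qed.

(** A pair of boxes on consecutive segments is one box on their union. *)
Lemma prob_segment_box2 s a p A B : mutually_independent X ->
  {in gtn (a + p)%N &, injective s} ->
  (forall i, measurable (A i)) -> (forall i, measurable (B i)) ->
  P (segment X s 0 a @^-1` box A `&` segment X s a p @^-1` box B) =
  (P (segment X s 0 a @^-1` box A) * P (segment X s a p @^-1` box B))%E.
Proof.
move=> ind sinj mA mB.
pose C l := if (l < a)%N then A l else B (l - a)%N.
have mC l : measurable (C l) by rewrite /C; case: ifP.
have CA (i : 'I_a) : C i = A i by rewrite /C ltn_ord.
have CB i : C (a + i)%N = B i by rewrite /C ltnNge leq_addr addKn.
rewrite !prob_segment_box //; last 2 first.
- move=> l l'; rewrite !inE => lp l'p /sinj.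
  by rewrite !inE !ltn_add2l => /(_ lp l'p)/addnI.
- by move=> l l' la l'a /sinj; apply; rewrite inE ltn_addr.
transitivity (P (\bigcap_(l in `I_(a + p)) (X (s l) @^-1` C l))).
  congr (P _); apply/seteqP; split=> w /=.
    move=> [hA hB] l /= lap; have [la|al] := ltnP l a.
      have := hA (Ordinal la); rewrite tnth_mktuple /=.
      by rewrite -(CA (Ordinal la)).
    have lp : (l - a < p)%N by rewrite ltn_subLR.
    have := hB (Ordinal lp); rewrite tnth_mktuple /= subnKC //.
    by rewrite -CB subnKC.
  move=> h; split=> i; rewrite tnth_mktuple.
    by have := h i (ltn_addr _ (ltn_ord i)); rewrite /= CA.
  by have := h (a + i)%N; rewrite /= ltn_add2l ltn_ord CB => /(_ isT).
rewrite prob_bigcap_indep // big_split_ord /=; congr (_ * _)%E.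
  by apply: eq_bigr => i _; rewrite CA.
by apply: eq_bigr => i _; rewrite CB.
Qed.

(** Boxes are replaced by arbitrary measurable sets one factor at a time. *)
Lemma segment_indep s a p (A : set (a.-tuple S)) (B : set (p.-tuple S)) :
  mutually_independent X -> {in gtn (a + p)%N &, injective s} ->
  measurable A -> measurable B ->
  P (segment X s 0 a @^-1` A `&` segment X s a p @^-1` B) =
  (P (segment X s 0 a @^-1` A) * P (segment X s a p @^-1` B))%E.
Proof.
move=> ind sinj mA mB.
apply: indep_of_box => //; try exact: measurable_segment.
  exact: measurable_segment_preimage.
move=> A' mA'; rewrite setIC muleC.
apply: indep_of_box => //; try exact: measurable_segment.
  by apply: measurable_segment_preimage; exact: measurable_box.
by move=> B' mB'; rewrite setIC muleC; exact: prob_segment_box2.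
Qed.

Lemma segment_identically_distributed s s' a a' p (B : set (p.-tuple S)) :
  iid X -> {in gtn p &, injective (fun l => s (a + l)%N)} ->
  {in gtn p &, injective (fun l => s' (a' + l)%N)} -> measurable B ->
  P (segment X s a p @^-1` B) = P (segment X s' a' p @^-1` B).
Proof.
move=> [ind idist] sinj s'inj mB.
pose Y : {RV P >-> p.-tuple S} :=
  mfun_Sub (mem_set (@measurable_segment s a p)).
pose Y' : {RV P >-> p.-tuple S} :=
  mfun_Sub (mem_set (@measurable_segment s' a' p)).
apply: (@measure_eq_of_box _ _ _ _
  (distribution P Y) (distribution P Y')) => //.
  by rewrite -[ltLHS]/(distribution P Y setT) probability_setT ltry.
move=> A mA; rewrite -[LHS]/(P (segment X s a p @^-1` box A)).
rewrite -[RHS]/(P (segment X s' a' p @^-1` box A)) !prob_segment_box //.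
by apply: eq_bigr => i _; exact: idist.
Qed.

(** The product over the first [k] blocks is a function [g] of the initial
segment of length [k * m], which is independent of the next block. *)
Lemma expectation_prod_blocks s (m k : nat) (f : m.-tuple S -> R) :
  mutually_independent X -> {in gtn (k * m)%N &, injective s} ->
  measurable_fun setT f -> (forall t, 0 <= f t) ->
  (\int[P]_w (\prod_(j < k) f (segment X s (j * m) m w))%:E =
   \prod_(j < k) \int[P]_w (f (segment X s (j * m) m w))%:E)%E.
Proof.
move=> ind + mf f0; elim: k => [|k IH] sinj.
  rewrite big_ord0; under eq_integral do rewrite big_ord0.
  by rewrite integral_cst // mul1e; exact: probability_setT.
have {}IH := IH (sub_in2 _ sinj).
rewrite big_ord_recr /= -IH; last first.
  by move=> l; rewrite !inE => /leq_trans; apply; rewrite leq_mul2r leqnSn orbT.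
(* Block [j] of a long tuple; the default value is never reached for
   [j < k]. *)
pose sub j (t : (k * m).-tuple S) : m.-tuple S :=
  [tuple nth point t (j * m + i) | i < m].
have msub j : measurable_fun setT (sub j).
  apply/measurable_fun_tnthP => i /=.
  have [lt|ge] := ltnP (j * m + i) (k * m).
    apply: (eq_measurable_fun (@tnth _ S ^~ (Ordinal lt))).
      by move=> t _; rewrite /= tnth_mktuple (tnth_nth point).
    exact: measurable_tnth.
  apply: (eq_measurable_fun (cst point)) => // t _.
  by rewrite /= tnth_mktuple nth_default // size_tuple.
pose g t := \prod_(j < k) f (sub j t).
have mg : measurable_fun setT g.
  by apply: measurable_prod => j _; exact: measurableT_comp.
have g0 t : 0 <= g t by exact: prodr_ge0.
have gE w : \prod_(j < k) f (segment X s (j * m) m w) =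
    g (segment X s 0 (k * m) w).
  apply: eq_bigr => j _; congr f; apply: eq_from_tnth => i.
  rewrite !tnth_mktuple.
  have lt : (j * m + i < k * m)%N by exact: block_index_lt.
  by rewrite -[(j * m + i)%N]/(nat_of_ord (Ordinal lt)) -tnth_nth tnth_mktuple.
under eq_integral do rewrite big_ord_recr /= gE EFinM.
under [in RHS]eq_integral do rewrite gE.
pose Y1 : {RV P >-> (k * m).-tuple S} :=
  mfun_Sub (mem_set (@measurable_segment s 0 (k * m))).
pose Y2 : {RV P >-> m.-tuple S} :=
  mfun_Sub (mem_set (@measurable_segment s (k * m) m)).
apply: (@expectation_mul_indep _ _ _ _ _ _ _ P Y1 Y2 (EFin \o g) (EFin \o f)).
- move=> A B mA mB; apply: segment_indep => //.
  by rewrite addnC -mulSn.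
- exact/measurable_EFinP.
- exact/measurable_EFinP.
- by move=> t; rewrite lee_fin.
- by move=> t; rewrite lee_fin.
Qed.

End independent_segments.

(** * Tails of sub-exponential variables *)

Lemma mmt_gen_funE d (Omega : measurableType d) (R : realType)
    (P : probability Omega R) (W : Omega -> R) (lambda : R) :
  ('M_P W lambda = \int[P]_w (expR (lambda * W w))%:E)%E.
Proof.
rewrite /mmt_gen_fun unlock; apply: eq_integral => w _ /=.
by rewrite mulrC.
Qed.

(** Chernoff's bound at the admissible [lambda] closest to [t / v], the
minimizer of the exponent [lambda ^+ 2 * v / 2 - lambda * t]. *)
Lemma subexp_upper_tail d (Omega : measurableType d) (R : realType)
    (P : probability Omega R) (W : {RV P >-> R}) (v a t : R) :
  0 < v -> 0 < a -> 0 < t ->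
  (forall lambda : R, 0 < lambda -> lambda <= 1 / a ->
    ('M_P W lambda <= (expR (lambda ^+ 2 * v / 2))%:E)%E) ->
  (P [set w | (t <= W w)%R] <=
   (expR (- (1 / 2) * Num.min (t ^+ 2 / v) (t / a)))%:E)%E.
Proof.
move=> v0 a0 t0 mgf.
(* Whichever term attains the minimum, [l * v <= t], so the exponent is at
   most [- l * t / 2]. *)
pose l := Num.min (t / v) (1 / a).
have l0 : 0 < l by rewrite lt_min !divr_gt0.
have la : l <= 1 / a by rewrite ge_min lexx orbT.
apply: (le_trans (chernoff W t l0)).
apply: (le_trans (lee_wpmul2r _ (mgf l l0 la))).
  by rewrite lee_fin expR_ge0.
rewrite -EFinM lee_fin -expRD ler_expR.
have key : Num.min (t ^+ 2 / v) (t / a) = t * l.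
  by rewrite /l minr_pMr ?ltW // mulrA -expr2 mulrA mulr1.
rewrite key.
have lv : l * v <= t by rewrite -ler_pdivlMr // ge_min lexx.
have : l * (l * v) <= l * t by rewrite ler_pM2l.
by move=> ?; lra.
Qed.

Lemma subexp_tail d (Omega : measurableType d) (R : realType)
    (P : probability Omega R) (W : {RV P >-> R}) (v a t : R) :
  0 < v -> 0 < a -> 0 < t ->
  (forall lambda : R, `|lambda| <= 1 / a ->
    ('M_P W lambda <= (expR (lambda ^+ 2 * v / 2))%:E)%E) ->
  (P [set w | (t <= `|W w|)%R] <=
   (2 * expR (- (1 / 2) * Num.min (t ^+ 2 / v) (t / a)))%:E)%E.
Proof.
move=> v0 a0 t0 mgf.
have mW : measurable_fun setT W by [].
have mNW : measurable_fun setT (fun w => - W w).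
  exact: measurableT_comp.
pose NW : {RV P >-> R} := mfun_Sub (mem_set mNW).
have mge (f : {RV P >-> R}) : measurable [set w | t <= f w].
  rewrite [X in measurable X](_ : _ = f @^-1` `[t, +oo[).
    by rewrite -[_ @^-1` _]setTI; exact: measurable_funP.
  by apply/seteqP; split => w; rewrite /= in_itv /= andbT.
rewrite [X in P X](_ : _ = [set w | t <= W w] `|` [set w | t <= NW w]);
  last first.
  apply/seteqP; split => w /=; rewrite ler_normr; first by move/orP.
  by move=> h; apply/orP.
apply: (le_trans (measureU2 P (mge W) (mge NW))).
rewrite mulr_natl mulr2n EFinD; apply: leeD; apply: subexp_upper_tail => //.
  by move=> l l0 la; apply: mgf; rewrite gtr0_norm.
move=> l l0 la; have := mgf (- l); rewrite normrN gtr0_norm // sqrrN => /(_ la).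
rewrite !mmt_gen_funE; apply: le_trans; rewrite le_eqVlt; apply/orP; left.
by apply/eqP; apply: eq_integral => w _ /=; rewrite mulrN mulNr.
Qed.

(** * The moment generating function of a U-statistic *)

(** The permuted order of the sample; the default [i0] makes it a sequence over
all of [nat], as [segment] expects. *)
Definition perm_seq (n : nat) (i0 : 'I_n) (sigma : {perm 'I_n}) (l : nat) :
  'I_n := sigma (insubd i0 l).

Lemma perm_seq_inj (n : nat) (i0 : 'I_n) (sigma : {perm 'I_n}) :
  {in gtn n &, injective (perm_seq i0 sigma)}.
Proof.
move=> l l'; rewrite !inE => ln l'n /perm_inj/(congr1 val).
by rewrite !val_insubd ln l'n.
Qed.

(** Hoeffding's decomposition. Each single block already averages to the
U-statistic over all permutations; averaging over [k] of them as well brings in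
the independence that shrinks the variance proxy by the factor [k]. *)
Lemma Ustat_mean_blocks (R : realType) (S : Type) (m n k : nat) (i0 : 'I_n)
    (h : m.-tuple S -> R) (x : 'I_n -> S) : (0 < k)%N -> (k * m <= n)%N ->
  Ustat h x = \sum_(sigma : {perm 'I_n}) n`!%:R^-1 *
    (k%:R^-1 *
     \sum_(j < k) h [tuple x (perm_seq i0 sigma (j * m + i)) | i < m]).
Proof.
move=> k0 kmn.
have mean j : (j < k)%N ->
    \sum_(sigma : {perm 'I_n})
      h [tuple x (perm_seq i0 sigma (j * m + i)) | i < m]
    = n`!%:R * Ustat h x.
  have nz : n`!%:R != 0 :> R by rewrite pnatr_eq0 -lt0n fact_gt0.
  move=> jk; pose c : m.-tuple 'I_n := [tuple insubd i0 (j * m + i)%N | i < m].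
  have lt (i : 'I_m) : (j * m + i < n)%N.
    by apply: leq_trans kmn; exact: block_index_lt.
  have uc : uniq c.
    rewrite map_inj_uniq ?enum_uniq // => i i' /(congr1 val).
    by rewrite !val_insubd !lt => /addnI/val_inj.
  transitivity (\sum_(s : {perm 'I_n}) h (map_tuple x (map_tuple s c))).
    apply: eq_bigr => s _; congr h; apply: eq_from_tnth => i.
    by rewrite tnth_mktuple tnth_map tnth_map tnth_mktuple.
  rewrite (sum_perm_map_tuple (fun i => h (map_tuple x i)) uc) card_ord.
  by rewrite /Ustat mulrA [_ * (_ / _)]mulrC mulfVK // mulr_natl.
rewrite -mulr_sumr -mulr_sumr exchange_big /=.
rewrite (eq_bigr (fun=> n`!%:R * Ustat h x)); last by move=> j _; exact: mean.
rewrite sumr_const card_ord; set u := Ustat h x.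
rewrite -[(_ * u) *+ k]mulr_natl !mulKf // pnatr_eq0 -lt0n //.
Qed.

Lemma prode_const_ord (R : realDomainType) (k : nat) (x : \bar R) :
  (\prod_(j < k) x = x ^+ k)%E.
Proof. by elim: k => [|k IH]; rewrite ?big_ord0 // big_ord_recl IH expeS. Qed.

Lemma measurable_Ustat d d' (Omega : measurableType d) (S : measurableType d')
    (R : realType) (P : probability Omega R) (m n : nat)
    (X : 'I_n -> {RV P >-> S}) (h : m.-tuple S -> R) :
  measurable_fun setT h ->
  measurable_fun setT (fun w => Ustat h (fun i => X i w)).
Proof.
move=> mh; apply: measurable_funM; first exact: measurable_cst.
under eq_fun do rewrite big_mkcond /=.
apply: measurable_sum => i; case: (uniq i); last exact: measurable_cst.
apply: measurableT_comp => //; apply/measurable_fun_tnthP => j.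
apply: (eq_measurable_fun (X (tnth i j))) => // w _.
by rewrite /= tnth_map.
Qed.

(** Convexity of the exponential moves the average over permutations outside,
and for each permutation the [k] disjoint blocks contribute independent factors
with the same expectation. *)
Lemma Ustat_mgf_le d d' (Omega : measurableType d) (S : measurableType d')
    (R : realType) (P : probability Omega R) (m n : nat)
    (X : 'I_n -> {RV P >-> S}) (h : m.-tuple S -> R) (s0 : nat -> 'I_n)
    (mu lambda : R) (k := (n %/ m)%N) :
  (0 < m)%N -> (m <= n)%N -> iid X -> measurable_fun setT h ->
  {in gtn m &, injective s0} ->
  ('M_P (fun w => (Ustat h (fun i => X i w) - mu)%R) lambda <=
   'M_P (fun w => (h (segment X s0 0 m w) - mu)%R) (lambda / k%:R) ^+ k)%E.
Proof.
move=> m0 mn Xiid mh s0inj.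
have i0 : 'I_n by exact: Ordinal (leq_trans m0 mn).
have k0 : (0 < k)%N by rewrite divn_gt0.
have kmn : (k * m <= n)%N by exact: leq_trunc_div.
pose f t : R := expR (lambda / k%:R * (h t - mu)).
have mf : measurable_fun setT f.
  apply: measurableT_comp => //; apply: measurable_funM.
    exact: measurable_cst.
  apply: measurable_funB => //; exact: measurable_cst.
have f0 t : 0 <= f t by exact: expR_ge0.
set M := ('M_P _ (lambda / _))%E.
have blockE s a : {in gtn m &, injective (fun l => s (a + l)%N)} ->
    (\int[P]_w (f (segment X s a m w))%:E = M)%E.
  move=> sinj; rewrite /M mmt_gen_funE.
  pose Y t := distribution P
    (mfun_Sub (mem_set (@measurable_segment _ _ _ _ _ P _ X t.1 t.2 m))).
  have E t b : (\int[P]_w (f (segment X t b m w))%:E =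
      \int[Y (t, b)]_y (f y)%:E)%E.
    by rewrite ge0_integral_distribution //; exact/measurable_EFinP.
  rewrite -[RHS]/(\int[P]_w (f (segment X s0 0 m w))%:E)%E.
  rewrite (E s a) (E s0 0%N); apply: eq_measure_integral => A mA _.
  rewrite -[LHS]/(P (segment X s a m @^-1` A)).
  rewrite -[RHS]/(P (segment X s0 0 m @^-1` A)).
  exact: segment_identically_distributed.
(* [q sigma] is [exp (lambda (V_sigma - mu))]. *)
pose q (sigma : {perm 'I_n}) w :=
  \prod_(j < k) f (segment X (perm_seq i0 sigma) (j * m) m w).
have mq sigma : measurable_fun setT (q sigma).
  apply: measurable_prod => j _; apply: measurableT_comp => //.
  exact: measurable_segment.
have q0 sigma w : 0 <= q sigma w by exact: prodr_ge0.
have qE sigma : (\int[P]_w (q sigma w)%:E = M ^+ k)%E.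
  have sinj := @perm_seq_inj n i0 sigma.
  rewrite (expectation_prod_blocks Xiid.1) //; last first.
    by move=> l l'; rewrite !inE => lk l'k; apply: sinj;
      rewrite inE (leq_trans _ kmn).
  rewrite (eq_bigr (fun=> M)); last first.
    move=> j _; apply: blockE => l l'; rewrite !inE => lm l'm.
    have lt i : (i < m)%N -> (j * m + i < n)%N.
      by move=> im; apply: leq_trans kmn; exact: block_index_lt.
    by move/sinj; rewrite !inE !lt // => /(_ isT isT)/addnI.
  by rewrite prode_const_ord.
pose c : R := n`!%:R^-1.
have c0 : 0 <= c by rewrite invr_ge0.
have c1 : \sum_(sigma : {perm 'I_n}) c = 1.
  have cP : #|{perm 'I_n}| = n`!.
    by rewrite -cardsT -[in RHS](card_ord n) -alt.card_Sym.
  by rewrite sumr_const cP -mulr_natl mulfV // pnatr_eq0 -lt0n fact_gt0.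
have pointwise w : expR (lambda * (Ustat h (fun i => X i w) - mu)) <=
    \sum_(sigma : {perm 'I_n}) c * q sigma w.
  rewrite (Ustat_mean_blocks i0 h (fun i => X i w) k0 kmn).
  have centre (V : {perm 'I_n} -> R) :
      lambda * (\sum_sigma c * V sigma - mu) =
      \sum_sigma c * (lambda * (V sigma - mu)).
    under [RHS]eq_bigr do rewrite mulrCA mulrBr.
    by rewrite -[in RHS]mulr_sumr sumrB -[in RHS]mulr_suml c1 mul1r.
  rewrite centre.
  apply: (le_trans (expR_mean_le _ _ _)) => //.
  apply: ler_sum => sigma _; apply: ler_wpM2l => //.
  rewrite /q /f -expR_sum ler_expR -mulr_sumr sumrB sumr_const card_ord.
  rewrite -[mu *+ k]mulr_natl le_eqVlt; apply/orP; left; apply/eqP.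
  by rewrite -mulrA [in RHS]mulrBr mulKf // pnatr_eq0 -lt0n.
have mcq sigma : measurable_fun setT (fun w => (c%:E * (q sigma w)%:E)%E).
  by apply/measurable_EFinP; apply: measurable_funM => //;
    exact: measurable_cst.
have cq0 sigma w : (0 <= c%:E * (q sigma w)%:E)%E.
  by rewrite -EFinM lee_fin mulr_ge0.
rewrite mmt_gen_funE.
apply: (@le_trans _ _
    (\int[P]_w (\sum_(sigma : {perm 'I_n}) c%:E * (q sigma w)%:E))%E).
  apply: ge0_le_integral => //.
  - apply/measurable_EFinP; apply: measurableT_comp => //.
    apply: measurable_funM; first exact: measurable_cst.
    by apply: measurable_funB => //; exact: measurable_Ustat.
  - exact: emeasurable_sum.
  - by move=> w _; rewrite sumEFin lee_fin.
rewrite ge0_integral_sum //.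
rewrite (eq_bigr (fun=> c%:E * M ^+ k)%E); last first.
  move=> sigma _; rewrite ge0_integralZl_EFin ?qE //.
  - by move=> w _; rewrite lee_fin.
  - exact/measurable_EFinP.
rewrite -(@ge0_sume_distrl _ _ _ (M ^+ k)%E predT (fun=> c%:E)); last first.
  by move=> sigma _; rewrite lee_fin.
by rewrite sumEFin c1 mul1e.
Qed.
(** * The deviation bounds *)

Unset Implicit Arguments.
Set Strict Implicit.

Theorem theorem4p4 (R : realType) (d d' : measure_display)
    (Omega : measurableType d) (S : measurableType d') (P : probability Omega R)
    (m n : nat) (hm : (2 <= m)%N) (hmn : (m <= n)%N)
    (X : 'I_n -> {RV P >-> S}) (hX : iid X)
    (h : m.-tuple S -> R) (hh : measurable_fun [set: m.-tuple S] h)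
    (nu alpha : R) (hnu : 0 < nu) (halpha : 0 < alpha) :
  let Z : Omega -> R := fun w => h [tuple X (widen_ord hmn j) w | j < m] in
  let mh : R := fine 'E_P[Z]%E in
  let U : Omega -> R := fun w => Ustat h (fun i => X i w) in
  let k : R := (n %/ m)%:R in
  sub_exponential P Z (nu ^+ 2) alpha ->
  (forall t : R, 0 < t ->
     (P [set w | (t <= `|U w - mh|)%R] <=
      (2 * expR (- (k / 2) * Num.min (t ^+ 2 / nu ^+ 2) (t / alpha)))%:E)%E)
  /\
  (forall delta : R, 0 < delta -> delta < 1 ->
     ((1 - delta)%:E <=
      P [set w | (`|U w - mh| <= nu * Num.sqrt (2 * ln (2 / delta) / k)
                                 + 2 * alpha * ln (2 / delta) / k)%R])%E).
Proof.
move=> Z mh U k [_ _ mgfZ].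
have m0 : (0 < m)%N by exact: (ltnW hm).
have n0 : (0 < n)%N by exact: (leq_trans m0 hmn).
have k0 : 0 < k by rewrite ltr0n divn_gt0.
pose s0 : nat -> 'I_n := insubd (Ordinal n0).
have s0inj : {in gtn m &, injective s0}.
  move=> l l'; rewrite !inE => lm l'm /(congr1 val).
  by rewrite !val_insubd !(leq_trans _ hmn).
have ZE : Z = fun w => h (segment X s0 0 m w).
  apply/funext => w; congr h; apply: eq_from_tnth => i; rewrite !tnth_mktuple.
  congr (X _ w); apply: val_inj; rewrite val_insubd /=.
  by rewrite (leq_trans (ltn_ord i) hmn).
have mW : measurable_fun setT (fun w => U w - mh).
  by apply: measurable_funB => //; exact: measurable_Ustat.
pose W : {RV P >-> R} := mfun_Sub (mem_set mW).
(* [U] is sub-exponential with parameters [(nu ^+ 2 / k, alpha / k)]. *)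
have mgfW (lambda : R) : `|lambda| <= 1 / (alpha / k) ->
    ('M_P W lambda <= (expR (lambda ^+ 2 * (nu ^+ 2 / k) / 2))%:E)%E.
  move=> hl.
  apply: (le_trans (Ustat_mgf_le mh lambda m0 hmn hX hh s0inj)).
  have hlk : `|lambda / k| <= 1 / alpha.
    rewrite normrM normfV (gtr0_norm k0) ler_pdivrMr //.
    by move: hl; rewrite !div1r invf_div mulrC.
  have := mgfZ _ hlk; rewrite -/mh ZE.
  set M := ('M_P _ _)%E => Mle.
  have M0 : (0 <= M)%E.
    by rewrite /M mmt_gen_funE integral_ge0 // => w _; rewrite lee_fin expR_ge0.
  have MX (j : nat) :
      (M ^+ j <= (expR ((lambda / k) ^+ 2 * nu ^+ 2 / 2) ^+ j)%:E)%E.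
    elim: j => [|j IH]; first by rewrite expr0.
    by rewrite expeS exprS EFinM lee_pmul // expe_ge0.
  apply: (le_trans (MX _)); rewrite lee_fin -expRM_natl ler_expR le_eqVlt.
  apply/orP; left; apply/eqP; rewrite -/k.
  by field; rewrite gt_eqF.
have tail (t : R) : 0 < t -> (P [set w | (t <= `|U w - mh|)%R] <=
    (2 * expR (- (k / 2) * Num.min (t ^+ 2 / nu ^+ 2) (t / alpha)))%:E)%E.
  move=> t0.
  have := @subexp_tail _ _ _ P W (nu ^+ 2 / k) (alpha / k) t.
  rewrite !divr_gt0 ?exprn_gt0 // => /(_ isT isT t0 mgfW).
  rewrite !invf_div !mulrA.
  have -> : Num.min (t ^+ 2 * k / nu ^+ 2) (t * k / alpha) =
      k * Num.min (t ^+ 2 / nu ^+ 2) (t / alpha).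
    rewrite minr_pMr ?ltW //; congr Num.min; rewrite mulrA; congr (_ / _);
      exact: mulrC.
  by rewrite mulrA mulNr div1r [2^-1 * k]mulrC -mulNr.
split=> // delta d0 d1.
pose L := ln (2 / delta).
have L0 : 0 < L by rewrite ln_gt0 // ltr_pdivlMr // mul1r; lra.
pose t := nu * Num.sqrt (2 * L / k) + 2 * alpha * L / k.
have t20 : 0 < 2 * alpha * L / k by rewrite divr_gt0 // !mulr_gt0.
have t10 : 0 < nu * Num.sqrt (2 * L / k).
  by rewrite mulr_gt0 // sqrtr_gt0 divr_gt0 // mulr_gt0.
have t0 : 0 < t by rewrite addr_gt0.
have mN : measurable_fun setT (fun w => `|W w|) by exact: measurableT_comp.
have mA : measurable [set w | `|W w| <= t].
  by rewrite -[X in measurable X]setTI; exact: measurable_fun_le.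
have mB : measurable [set w | t <= `|W w|].
  by rewrite -[X in measurable X]setTI; exact: measurable_fun_le.
rewrite -[X in P X]/[set w | `|W w| <= t].
rewrite -[X in P X]setCK probability_setC; last exact: measurableC.
rewrite EFinB leeB //.
apply: (@le_trans _ _ (P [set w | (t <= `|U w - mh|)%R])).
  apply: le_measure; rewrite ?inE //; first exact: measurableC.
  by move=> w /= /negP; rewrite -ltNge => /ltW.
apply: (le_trans (tail t t0)); rewrite lee_fin.
(* Each of the two summands of [t] takes care of one term of the minimum. *)
have minL : 2 * L / k <= Num.min (t ^+ 2 / nu ^+ 2) (t / alpha).
  rewrite le_min; apply/andP; split.
    rewrite ler_pdivlMr ?exprn_gt0 //.
    have -> : 2 * L / k * nu ^+ 2 = (nu * Num.sqrt (2 * L / k)) ^+ 2.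
      by rewrite exprMn sqr_sqrtr ?divr_ge0 ?ltW ?mulr_gt0 // mulrC.
    by rewrite lerXn2r ?nnegrE ?ltW // /t ltrDl.
  rewrite ler_pdivlMr //.
  have -> : 2 * L / k * alpha = 2 * alpha * L / k by lra.
  by rewrite /t lerDr ltW.
have : expR (- (k / 2) * Num.min (t ^+ 2 / nu ^+ 2) (t / alpha)) <= expR (- L).
  rewrite ler_expR mulNr lerN2.
  have -> : L = k / 2 * (2 * L / k) by field; rewrite gt_eqF.
  by rewrite ler_pM2l // divr_gt0.
rewrite expRN lnK ?posrE ?divr_gt0 // invf_div.
by move=> ?; lra.
Qed.
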